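(* Let $\varphi$ be a trihexagonal magic figure of order $n\ge 1$. Then: (1) every lattice triangle has the same vertex-sum (the sum of the values of $\varphi$ at its three vertices); (2) every lattice hexagon has the same vertex-sum (the sum of the values of $\varphi$ at its six vertices), and this sum equals twice the common triangle sum of (1); (3) for every lattice parallelogram, the sum of the values of $\varphi$ at one pair of opposite vertices equals the sum of the values of $\varphi$ at the other pair of opposite vertices.
   Context: The trihexagonal region of order $n\ge 1$, in barycentric coordinates: take the triangular array of points $(i,j,k)$ of nonnegative integers with $i+j+k=2n-1$ (an equilateral triangle with $2n$ points on each side), and remove all points whose three coordinates are all odd. The remaining set $V_n$ consists of the points with exactly two even coordinates and one odd coordinate; $|V_n|=\frac{3n(n+1)}{2}$. Let $e_1,e_2,e_3$ be the standard basis vectors. Faces of the region: - Upright triangular faces: the sets $\{P+e_1,P+e_2,P+e_3\}$, where $P$ is a triple of nonnegative even integers with coordinate sum $2n-2$. - Inverted triangular faces: the sets $\{Q-e_1,Q-e_2,Q-e_3\}$, where $Q$ is a triple of positive even integers with coordinate sum $2n$. - Hexagonal faces: for each removed point $c$ (a triple of positive odd integers with sum $2n-1$), the set of its six neighbours $c+e_a-e_b$, $a\neq b$. A trihexagonal magic figure of order $n$ is a bijection $\varphi:V_n\to\{1,2,\dots,\frac{3n(n+1)}{2}\}$ such that all triangular faces (upright and inverted) have the same sum $T_n$ of their three vertex labels, all hexagonal faces have the same sum $H_n$ of their six vertex labels, and $H_n=2T_n$. The lines of the configuration are the lines $i=\text{const}$, $j=\text{const}$, $k=\text{const}$ with an even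 constant in $\{0,2,\dots,2n-2\}$ (the straight lines carrying the edges of the tiling). A lattice triangle, lattice hexagon or lattice parallelogram is a non-degenerate convex polygon with 3 sides, with 6 sides, or with 4 sides forming a parallelogram, respectively, whose vertices lie in $V_n$ and each of whose sides lies along a line of the configuration. Triangles may be upright or inverted; parallelograms may have any of the three orientations (interior angles $60^\circ$ and $120^\circ$); lattice hexagons have all interior angles $120^\circ$ and need not be regular. With these conventions triangles and hexagons have odd side lengths and parallelograms have even side lengths (measured in lattice steps). *)

(* Defs.v *)
From HB Require Import structures.
From mathcomp Require Import all_boot all_order all_algebra.
Set Implicit Arguments.
Unset Strict Implicit.
Unset Printing Implicit Defensive.
Import Order.TTheory GRing.Theory Num.Theory.
Local Open Scope ring_scope.

(* Points are barycentric triples (i, j, k), as integer row vectors, so that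
   translates such as P + e_a and c + e_a - e_b are vector operations. *)
Definition point := 'rV[int]_3.

Definition e (a : 'I_3) : point := delta_mx 0 a.

Definition evenz (x : int) : bool := (2 %| x)%Z.

Definition coord_sum (P : point) : int := \sum_(a < 3) P 0 a.

Definition region (n : nat) : pred point := [pred P : point |
  [&& [forall a, 0 <= P 0 a],
      coord_sum P == (2 * n)%:Z - 1
    & ~~ [forall a, ~~ evenz (P 0 a)]]].

(* Faces are indexed by their centre: P + e_a, Q - e_a, c + e_a - e_b are the
   vertices. *)
Definition upright_center (n : nat) (P : point) : Prop :=
  (forall a, 0 <= P 0 a /\ evenz (P 0 a)) /\ coord_sum P = (2 * n)%:Z - 2.

Definition inverted_center (n : nat) (Q : point) : Prop :=
  (forall a, 0 < Q 0 a /\ evenz (Q 0 a)) /\ coord_sum Q = (2 * n)%:Z.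

Definition hexagon_center (n : nat) (c : point) : Prop :=
  (forall a, 0 < c 0 a /\ ~~ evenz (c 0 a)) /\ coord_sum c = (2 * n)%:Z - 1.

Definition nb_points (n : nat) : nat := ((3 * n * n.+1) %/ 2)%N.

(* phi is a total function, but only its values on region n matter. *)
Definition labelling (n : nat) (phi : point -> nat) : Prop :=
  [/\ forall P, P \in region n -> (1 <= phi P <= nb_points n)%N,
      {in region n &, injective phi}
    & forall m : nat, (1 <= m <= nb_points n)%N ->
        exists2 P, P \in region n & phi P = m].

Definition magic_figure (n : nat) (phi : point -> nat) : Prop :=
  labelling n phi /\
  exists T H : nat,
    [/\ forall P, upright_center n P -> (\sum_(a < 3) phi (P + e a)%R)%N = T,
        forall Q, inverted_center n Q -> (\sum_(a < 3) phi (Q - e a)%R)%N = T,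
        forall c, hexagon_center n c ->
          (\sum_(a < 3) \sum_(b < 3 | a != b) phi (c + e a - e b)%R)%N = H
      & H = (2 * T)%N].

(* The segment from P to Q lies along a line of the configuration: some
   coordinate takes the same even value in {0, 2, ..., 2n-2} at both ends. *)
Definition along_line (n : nat) (P Q : point) : Prop :=
  exists (a : 'I_3) (x : int),
    [/\ 0 <= x <= (2 * n)%:Z - 2, evenz x, P 0 a = x & Q 0 a = x].

(* Cross product of two vectors of the plane i + j + k = 0, computed in the
   affine chart (i, j); it is positive on (e_2 - e_1, e_3 - e_1). *)
Definition cross (u v : point) : int := u 0 0 * v 0 1 - u 0 1 * v 0 0.

(* A polygon with m sides is given by its vertices p 0, ..., p (m-1) in cyclic
   order; ordS is the cyclic successor on 'I_m. *)
Definition side (m : nat) (p : 'I_m -> point) (i : 'I_m) : point :=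
  p (ordS i) - p i.

(* Non-degenerate convexity, with the vertices listed counterclockwise (every
   convex polygon has such a listing): each vertex not on a given side lies
   strictly to its left. In particular no interior angle is straight. *)
Definition convex_polygon (m : nat) (p : 'I_m -> point) : Prop :=
  forall i j : 'I_m, j != i -> j != ordS i -> 0 < cross (side p i) (p j - p i).

Definition lattice_polygon (n m : nat) (p : 'I_m -> point) : Prop :=
  [/\ convex_polygon p,
      forall i, p i \in region n
    & forall i, along_line n (p i) (p (ordS i))].

Definition lattice_triangle (n : nat) (p : 'I_3 -> point) : Prop :=
  lattice_polygon n p.

Definition lattice_hexagon (n : nat) (p : 'I_6 -> point) : Prop :=
  lattice_polygon n p.

Definition lattice_parallelogram (n : nat) (p : 'I_4 -> point) : Prop :=
  lattice_polygon n p /\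
  forall i : 'I_4, cross (side p i) (side p (ordS (ordS i))) = 0.

Definition vertex_sum (phi : point -> nat) (m : nat) (p : 'I_m -> point) : nat :=
  (\sum_(i < m) phi (p i))%N.

(* Main.v *)
Require Import Defs.
From mathcomp Require Import all_boot all_order all_algebra zify ring.
Import Order.TTheory GRing.Theory Num.Theory.
Local Open Scope ring_scope.

(** Each point of the region is the crossing of two lines of the
    configuration, and a triangle is determined by three lines, one of each
    family. If the lines are i = 2x, j = 2y, k = 2z, the triangular faces are
    the triangles with x + y + z equal to n - 1 (upright) or n (inverted).
    Three upright faces and the hexagonal face that they surround also give
    the value T of the sum for x + y + z = n - 2 (cut_sum_around_hexagon);
    this is where H = 2 T is used.

    Three consecutive values of x + y + z are enough to take a mixed second
    difference in two of the variables: it kills the labels on the third line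
    and shows that the labels at the crossings of two families have vanishing
    alternating sum on each unit parallelogram (label_unit_parallelogram).
    Hence such a label is a share depending on the first line plus a share
    depending on the second (label_split). A first difference then shows that
    the two shares of a line, for its crossings with the two other families,
    add up to a quantity that depends only on the family of the line
    (line_constE); these quantities for the three families add up to 2 T, as
    labels are doubled (sum_line_const).

    The vertices of a polygon are crossings of consecutive sides. For a
    triangle or a hexagon the neighbours of each side belong to the two other
    families, so each side contributes the constant of its family
    (sum_vertices): each family occurs once for a triangle and twice for a
    hexagon. For a parallelogram the shares cancel in the alternating sum. It
    remains to read the families of the sides from convexity: each side turns
    left by 60 or 120 degrees (side_turn), and no oriented direction occurs
    twice (heading_inj), which for a hexagon forces every turn to be 60
    degrees (hexagon_turn). *)

Set Implicit Arguments.
Unset Strict Implicit.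
Unset Printing Implicit Defensive.

(** * Points in barycentric coordinates *)

Lemma mem_distinct3 (a b c : 'I_3) :
  uniq [:: a; b; c] -> forall i, i \in [:: a; b; c].
Proof.
move=> abc i; have [| |_ ->] := uniq_min_size (s2 := enum 'I_3) abc.
- by move=> j _; rewrite mem_enum.
- by rewrite size_enum_ord.
- by rewrite mem_enum.
Qed.

(** The three coordinates play symmetric roles. Naming them by an arbitrary
    enumeration a, b, c of the index set lets one statement cover all the
    orientations of a face or of a line; the hypothesis uniq [:: a; b; c] says
    that this is an enumeration. *)
Lemma sum_distinct3 (V : nmodType) (f : 'I_3 -> V) (a b c : 'I_3) :
  uniq [:: a; b; c] -> \sum_i f i = f a + f b + f c.
Proof.
move=> abc.
have -> : \sum_i f i = \sum_(i <- [:: a; b; c]) f i.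
  rewrite -big_enum /=; apply/perm_big/uniq_perm; rewrite ?enum_uniq // => i.
  by rewrite mem_enum mem_distinct3.
by rewrite !big_cons big_nil addr0 addrA.
Qed.

Lemma distinct3E (a b c : 'I_3) : uniq [:: a; b; c] ->
  ((a == b) = false) * ((b == a) = false) * ((a == c) = false) *
  ((c == a) = false) * ((b == c) = false) * ((c == b) = false).
Proof.
rewrite /= !inE negb_or andbT => /andP[/andP[ab ac] bc].
by rewrite ![b == a]eq_sym ![c == _]eq_sym (negPf ab) (negPf ac) (negPf bc).
Qed.

Lemma all_distinct3 (a b c : 'I_3) (R : 'I_3 -> Prop) : uniq [:: a; b; c] ->
  R a -> R b -> R c -> forall i, R i.
Proof.
move=> abc Ra Rb Rc i.
by have := mem_distinct3 abc i; rewrite !inE => /or3P[] /eqP->.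
Qed.

Lemma eq_point (a b c : 'I_3) (P Q : point) : uniq [:: a; b; c] ->
  P 0 a = Q 0 a -> P 0 b = Q 0 b -> P 0 c = Q 0 c -> P = Q.
Proof. by move=> abc *; apply/rowP; apply: (all_distinct3 abc). Qed.

Definition triple (a b : 'I_3) (x y z : int) : point :=
  \row_i (if i == a then x else if i == b then y else z).

Lemma tripleE (a b c : 'I_3) x y z : uniq [:: a; b; c] ->
  (triple a b x y z 0 a = x) * (triple a b x y z 0 b = y) *
  (triple a b x y z 0 c = z).
Proof. by move=> abc; rewrite !mxE !(distinct3E abc) !eqxx. Qed.

Lemma coord_sumE (a b c : 'I_3) P : uniq [:: a; b; c] ->
  coord_sum P = P 0 a + P 0 b + P 0 c.
Proof. exact: sum_distinct3. Qed.

Lemma distinct3_rot (a b c : 'I_3) : uniq [:: a; b; c] -> uniq [:: b; c; a].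
Proof. by rewrite -(rot_uniq 1). Qed.

Lemma distinct3_swap (a b c : 'I_3) : uniq [:: a; b; c] -> uniq [:: b; a; c].
Proof. by move=> abc; rewrite /= !inE !(distinct3E abc). Qed.

Lemma uniq_third (a b : 'I_3) : a != b -> exists c, uniq [:: a; b; c].
Proof.
move=> ab; have /card_gt0P[c] : (0 < #|~: [set a; b]|)%N.
  by rewrite cardsCs setCK card_ord cards2; case: (_ != _).
rewrite !inE negb_or => /andP[ca cb].
by exists c; rewrite /= !inE negb_or ab ![_ == c]eq_sym ca cb.
Qed.

Ltac by_coordinates abc :=
  apply: (eq_point abc); rewrite !mxE ?eqxx ?(distinct3E abc) /=; lia.

(** * Oriented directions of the sides *)

(** The lines of the configuration have six oriented directions, at angles
    multiple of 60 degrees. They are numbered counterclockwise by the additive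
    group 'I_6, so that turning left is adding. The axis is the coordinate
    that is constant along direction d: it is - d mod 3, since turning by 60
    degrees moves from one family of lines to the next. *)
Definition axis (d : 'I_6) : 'I_3 := inZp (2 * d).

(** The six vectors e_a - e_b; d and d + 3 share their axis and differ in
    parity, hence in sign. *)
Definition heading (d : 'I_6) : point :=
  (-1) ^+ d *: (e (axis d + 1) - e (axis d + 1 + 1)).

Definition heads (u : point) (d : 'I_6) : Prop :=
  exists2 l : int, 0 < l & u = l *: heading d.

Lemma uniq_succ3 (a : 'I_3) : uniq [:: a; a + 1; a + 1 + 1].
Proof. by case: a => [[|[|[|]]]]. Qed.

Lemma axis_even (a : 'I_3) : axis (inZp (2 * a)) = a.
Proof. by case: a => [[|[|[|//]]] ?]; apply: val_inj. Qed.

Lemma axis_odd (a : 'I_3) : axis (inZp (2 * a + 3)) = a.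
Proof. by case: a => [[|[|[|//]]] ?]; apply: val_inj. Qed.

Lemma heading_even (a : 'I_3) :
  heading (inZp (2 * a)) = e (a + 1) - e (a + 1 + 1).
Proof.
rewrite /heading axis_even -signr_odd.
by case: a => [[|[|[|//]]] ?]; rewrite expr0 scale1r.
Qed.

Lemma heading_odd (a : 'I_3) :
  heading (inZp (2 * a + 3)) = - (e (a + 1) - e (a + 1 + 1)).
Proof.
rewrite /heading axis_odd -signr_odd.
by case: a => [[|[|[|//]]] ?]; rewrite expr1 scaleN1r.
Qed.

(** The two nonzero coordinates of u are opposite, and the sign of one of them
    selects between the two directions of axis a. *)
Lemma exists_heading (a : 'I_3) (u : point) :
  u 0 a = 0 -> coord_sum u = 0 -> u != 0 -> exists2 d, axis d = a & heads u d.
Proof.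
move=> ua sum_u u_neq0; have abc := uniq_succ3 a.
rewrite (coord_sumE _ abc) ua in sum_u.
set t := u 0 (a + 1) in sum_u.
have def_u : u = t *: (e (a + 1) - e (a + 1 + 1)).
  apply: (eq_point abc); rewrite ?ua !mxE ?eqxx ?(distinct3E abc) /=.
  - by rewrite subr0 mulr0.
  - by rewrite subr0 mulr1.
  - by rewrite sub0r mulrN1; lia.
have [t_gt0|t_lt0|t0] := ltrgt0P t; last 1 first.
- by rewrite def_u t0 scale0r eqxx in u_neq0.
- exists (inZp (2 * a)); first exact: axis_even.
  by exists t; rewrite // heading_even.
- exists (inZp (2 * a + 3)); first exact: axis_odd.
  by exists (- t); rewrite ?oppr_gt0 // heading_odd scalerN scaleNr opprK.
Qed.

Lemma crossZ l k u v : cross (l *: u) (k *: v) = l * k * cross u v.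
Proof. by rewrite /cross !mxE; ring. Qed.

Lemma crossNr u v : cross u (- v) = - cross u v.
Proof. by rewrite /cross !mxE; ring. Qed.

(** Up to a positive factor this is the sine of the angle between the two
    directions, so its sign depends on the difference in Z/6 alone. *)
Lemma cross_heading d d' :
  cross (heading d) (heading d') =
  nth 0 [:: 0; 1; 1; 0; -1; -1] (d' - d)%R.
Proof.
by case: d d' => [[|[|[|[|[|[|]]]]]] //= ?] [[|[|[|[|[|[|]]]]]] //= ?];
  rewrite /cross /heading !mxE.
Qed.

Lemma cross_heads u v d d' : heads u d -> heads v d' ->
  (cross u v == 0) = ((d' == d) || (d' == d + inZp 3)).
Proof.
move=> [l l0 ->] [k k0 ->]; rewrite crossZ cross_heading !mulf_eq0.
rewrite (gt_eqF l0) (gt_eqF k0) -(subr_eq0 d' d) -(subr_eq0 d') opprD addrA.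
by case: (d' - d)%R => [[|[|[|[|[|[|]]]]]] ?].
Qed.

Lemma cross_heads_gt0 u v d d' : heads u d -> heads v d' ->
  0 < cross u v -> (d' == d + inZp 1) || (d' == d + inZp 2).
Proof.
move=> [l l0 ->] [k k0 ->]; rewrite crossZ cross_heading.
rewrite pmulr_rgt0 ?mulr_gt0 //.
rewrite -!(subr_eq0 d') !opprD !addrA.
by case: (d' - d) => [[|[|[|[|[|[|]]]]]] ?].
Qed.

(** Equally oriented vectors have the same left half-plane. *)
Lemma cross_gt0_same_heading u v d w : heads u d -> heads v d ->
  (0 < cross u w) = (0 < cross v w).
Proof.
move=> [l l0 ->] [k k0 ->]; rewrite -[w]scale1r !crossZ !mulr1.
by rewrite !pmulr_rgt0.
Qed.

Lemma val_ordS m (i : 'I_m) : val (ordS i) = if i.+1 == m then 0%N else i.+1.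
Proof.
rewrite /=; case: eqP => [->|/eqP ne]; first by rewrite modnn.
by rewrite modn_small // ltn_neqAle ne ltn_ord.
Qed.

Lemma ordS_neq m (i : 'I_m) : (2 < m)%N ->
  (ordS i != i) && (ordS (ordS i) != i).
Proof.
move=> m3; rewrite -!val_eqE !val_ordS; case: i => k lt_km /=.
by case: (k.+1 =P m) => ?; case: ifP => /eqP ?; lia.
Qed.

Lemma cross_side_next m (p : 'I_m -> point) i : (2 < m)%N ->
  convex_polygon p -> 0 < cross (side p i) (side p (ordS i)).
Proof.
move=> m3 cvx_p; have /andP[S1 S2] := ordS_neq i m3.
have /andP[S3 _] := ordS_neq (ordS i) m3.
suff -> : cross (side p i) (side p (ordS i)) =
  cross (side p i) (p (ordS (ordS i)) - p i) by exact: cvx_p.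
by rewrite /side /cross !mxE; ring.
Qed.

Lemma region_coord_sum n P : P \in region n -> coord_sum P = (2 * n)%:Z - 1.
Proof. by case/and3P=> _ /eqP. Qed.

Lemma coord_sumB P Q : coord_sum (P - Q) = coord_sum P - coord_sum Q.
Proof. by rewrite /coord_sum -sumrB; apply: eq_bigr => i _; rewrite !mxE. Qed.

(** Strict convexity excludes sides of length zero, so that each side has an
    oriented direction; its axis carries the even constant of the line. *)
Lemma polygon_headings n m (p : 'I_m -> point) : (2 < m)%N ->
  lattice_polygon n p ->
  exists d : 'I_m -> 'I_6,
    [/\ forall i, heads (side p i) (d i),
        forall i, evenz (p i 0 (axis (d i)))
      & forall i, p (ordS i) 0 (axis (d i)) = p i 0 (axis (d i))].
Proof.
move=> m3 [cvx_p reg_p line_p]; suff dir i : exists d : 'I_6,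
    [/\ heads (side p i) d, evenz (p i 0 (axis d))
      & p (ordS i) 0 (axis d) = p i 0 (axis d)]
  by have [d side_d] := fin_all_exists dir;
     exists d; split=> i; case: (side_d i).
have [a [x [_ ev_x ia Sa]]] := line_p i.
have [|||d def_a head_d] := @exists_heading a (side p i).
- by rewrite !mxE ia Sa subrr.
- by rewrite coord_sumB !(region_coord_sum (reg_p _)) subrr.
- apply/eqP => s0; have := cross_side_next i m3 cvx_p.
  by rewrite s0 /cross !mxE !mul0r subrr ltxx.
by exists d; rewrite def_a ia Sa.
Qed.

(** Each family of lines carries two opposite directions. *)
Lemma sum_axis (V : nmodType) (f : 'I_3 -> V) :
  \sum_d f (axis d) = (\sum_a f a) *+ 2.
Proof.
have injl : injective (fun i : 'I_3 => axis (lshift 3 i)).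
  by move=> [[|[|[|//]]] ?] [[|[|[|//]]] ?] // _; apply: val_inj.
have injr : injective (fun i : 'I_3 => axis (rshift 3 i)).
  by move=> [[|[|[|//]]] ?] [[|[|[|//]]] ?] // _; apply: val_inj.
rewrite (@big_split_ord _ _ _ 3 3) mulr2n /=.
congr (_ + _); first by rewrite [RHS](reindex_inj injl).
by rewrite [RHS](reindex_inj injr).
Qed.

Section Headings.

Variables (m : nat) (p : 'I_m -> point) (d : 'I_m -> 'I_6).
Hypotheses (m3 : (2 < m)%N) (cvx_p : convex_polygon p).
Hypothesis head_d : forall i, heads (side p i) (d i).

Lemma side_turn i :
  (d (ordS i) == d i + inZp 1) || (d (ordS i) == d i + inZp 2).
Proof. exact: cross_heads_gt0 (cross_side_next i m3 cvx_p). Qed.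

(** Two sides with the same oriented direction would each have to lie strictly
    to the left of the other. *)
Lemma heading_inj : injective d.
Proof.
have notS i : d i != d (ordS i).
  by case/orP: (side_turn i) => /eqP->; case: (d i) => [[|[|[|[|[|[|]]]]]] ?].
move=> i j dij; apply/eqP; apply: contraT => ne_ij.
have iS : i != ordS j by apply: contraNneq (notS j) => <-; rewrite dij.
have jS : j != ordS i by apply: contraNneq (notS i) => <-; rewrite dij.
have hi := head_d i; rewrite dij in hi.
have := cvx_p ne_ij iS; rewrite eq_sym in ne_ij.
have := cvx_p ne_ij jS; rewrite (cross_gt0_same_heading _ hi (head_d j)).
rewrite -[p i - p j]opprB crossNr oppr_gt0 => w_gt0 /lt_trans/(_ w_gt0).
by rewrite ltxx.
Qed.

End Headings.

Lemma axis_turn d d' : (d' == d + inZp 1) || (d' == d + inZp 2) ->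
  axis d != axis d'.
Proof. by case/orP=> /eqP->; case: d => [[|[|[|[|[|[|]]]]]] ?]. Qed.

(** Each of the six turns of a hexagon is 1 or 2, and together they add up to
    0 in Z/6, hence to 6 or to 12. In the second case all of them are 2, and
    three steps bring the direction back to its initial value, against
    heading_inj. *)
Lemma hexagon_turn (p : 'I_6 -> point) (d : 'I_6 -> 'I_6) i :
  convex_polygon p -> (forall i, heads (side p i) (d i)) ->
  d (ordS i) = d i + inZp 1.
Proof.
move=> cvx_p head_d; have lt26 : (2 < 6)%N by [].
have inj_d := heading_inj lt26 cvx_p head_d.
have step j : exists t : bool, d (ordS j) = d j + inZp (1 + t).
  by case/orP: (side_turn lt26 cvx_p head_d j) => /eqP->;
    [exists false | exists true].
have [t0 e0] := step i; have [t1 e1] := step (ordS i).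
have [t2 e2] := step (ordS (ordS i)).
have [t3 e3] := step (ordS (ordS (ordS i))).
have [t4 e4] := step (ordS (ordS (ordS (ordS i)))).
have [t5 e5] := step (ordS (ordS (ordS (ordS (ordS i))))).
have S6i : ordS (ordS (ordS (ordS (ordS (ordS i))))) = i.
  by apply: val_inj; case: (i) => [[|[|[|[|[|[|]]]]]] ?].
have S3i : ordS (ordS (ordS i)) != i.
  by case: (i) => [[|[|[|[|[|[|]]]]]] ?].
(* e5 now says that the six turns add up to 0; below, three turns do not. *)
rewrite S6i e4 e3 e2 e1 e0 -!addrA in e5.
rewrite e0.
have {S3i} : d (ordS (ordS (ordS i))) != d i by rewrite (inj_eq inj_d).
rewrite e2 e1 e0 -!addrA -subr_eq0 addrAC subrr add0r; move/eqP: e5.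
rewrite -subr_eq0 opprD addNKr oppr_eq0.
by case: t0 t1 t2 t3 t4 t5 {e0 e1 e2 e3 e4} => [] [] [] [] [] [].
Qed.

(** * Additive structure of a magic labelling *)

Section Magic.

Variables (n : nat) (phi : point -> nat) (T : nat).

(** Every point of the region has two even coordinates, that is, it is the
    intersection of two lines of the configuration. Lines are indexed by half
    of their even constant, so that the ranges are intervals of nat. *)
Definition crossing (a b : 'I_3) (x y : nat) : point :=
  triple a b (2 * x)%:Z (2 * y)%:Z ((2 * n)%:Z - 1 - (2 * x)%:Z - (2 * y)%:Z).

Lemma crossingC (a b c : 'I_3) x y : uniq [:: a; b; c] ->
  crossing b a y x = crossing a b x y.
Proof. by move=> abc; by_coordinates abc. Qed.

Definition label (a b : 'I_3) (x y : nat) : int := (phi (crossing a b x y))%:Z.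

(** The vertex sum of the triangle cut out by three lines, one of each family.
    All these sums turn out to be equal; the triangular faces are special
    cases. *)
Definition cut_sum (a b c : 'I_3) (x y z : nat) : int :=
  label a b x y + label b c y z + label c a z x.

Lemma labelC (a b c : 'I_3) x y : uniq [:: a; b; c] ->
  label b a y x = label a b x y.
Proof. by move=> abc; rewrite /label (crossingC _ _ abc). Qed.

Hypothesis upright : forall P, upright_center n P ->
  (\sum_(a < 3) phi (P + e a)%R)%N = T.
Hypothesis inverted : forall Q, inverted_center n Q ->
  (\sum_(a < 3) phi (Q - e a)%R)%N = T.
Hypothesis hexagon : forall c, hexagon_center n c ->
  (\sum_(a < 3) \sum_(b < 3 | a != b) phi (c + e a - e b)%R)%N = (2 * T)%N.

Lemma cut_sum_upright a b c x y z : uniq [:: a; b; c] ->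
  (x + y + z + 1 = n)%N -> cut_sum a b c x y z = T%:Z.
Proof.
move=> abc def_n.
pose P := triple a b (2 * x)%:Z (2 * y)%:Z (2 * z)%:Z.
have centP : upright_center n P.
  split; last by rewrite (coord_sumE _ abc) !(tripleE _ _ _ abc); lia.
  apply: (all_distinct3 abc); rewrite !(tripleE _ _ _ abc) /evenz; lia.
rewrite -(upright centP) (sum_distinct3 _ abc) /cut_sum /label.
have -> : crossing a b x y = P + e c by by_coordinates abc.
have -> : crossing b c y z = P + e a by by_coordinates abc.
have -> : crossing c a z x = P + e b by by_coordinates abc.
lia.
Qed.

Lemma cut_sum_inverted a b c x y z : uniq [:: a; b; c] ->
  (0 < x)%N -> (0 < y)%N -> (0 < z)%N -> (x + y + z = n)%N ->
  cut_sum a b c x y z = T%:Z.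
Proof.
move=> abc x0 y0 z0 def_n.
pose Q := triple a b (2 * x)%:Z (2 * y)%:Z (2 * z)%:Z.
have centQ : inverted_center n Q.
  split; last by rewrite (coord_sumE _ abc) !(tripleE _ _ _ abc); lia.
  apply: (all_distinct3 abc); rewrite !(tripleE _ _ _ abc) /evenz; lia.
rewrite -(inverted centQ) (sum_distinct3 _ abc) /cut_sum /label.
have -> : crossing a b x y = Q - e c by by_coordinates abc.
have -> : crossing b c y z = Q - e a by by_coordinates abc.
have -> : crossing c a z x = Q - e b by by_coordinates abc.
lia.
Qed.

(** Prolonging alternate sides of a hexagonal face gives a triangle of side 3,
    made of that hexagon and of three upright faces at its corners. The six
    inner points are counted by the upright faces as well, so the three
    corners sum to 3 T - 2 T. *)
Lemma cut_sum_around_hexagon a b c x y z : uniq [:: a; b; c] ->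
  (x + y + z + 2 = n)%N -> cut_sum a b c x y z = T%:Z.
Proof.
move=> abc def_n.
pose C := triple a b (2 * x + 1)%:Z (2 * y + 1)%:Z (2 * z + 1)%:Z.
have centC : hexagon_center n C.
  split; last by rewrite (coord_sumE _ abc) !(tripleE _ _ _ abc); lia.
  apply: (all_distinct3 abc); rewrite !(tripleE _ _ _ abc) /evenz; lia.
have := hexagon centC; rewrite (sum_distinct3 _ abc).
rewrite !(big_mkcond (fun b => _ != b)) !(sum_distinct3 _ abc).
rewrite !eqxx !(distinct3E abc) /=.
have -> : C + e a - e b = crossing a b x.+1 y by by_coordinates abc.
have -> : C + e b - e a = crossing a b x y.+1 by by_coordinates abc.
have -> : C + e b - e c = crossing b c y.+1 z by by_coordinates abc.
have -> : C + e c - e b = crossing b c y z.+1 by by_coordinates abc.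
have -> : C + e c - e a = crossing c a z.+1 x by by_coordinates abc.
have -> : C + e a - e c = crossing c a z x.+1 by by_coordinates abc.
have := @cut_sum_upright a b c x.+1 y z abc.
have := @cut_sum_upright a b c x y.+1 z abc.
have := @cut_sum_upright a b c x y z.+1 abc.
rewrite /cut_sum /label; lia.
Qed.

(** With the third line fixed, the alternating sum over two consecutive lines
    of each of the other families cancels every label except those at the
    crossings of these two families. The third line is chosen so that all four
    triangles are among those already known. *)
Lemma label_unit_parallelogram a b c x y : uniq [:: a; b; c] ->
  (x + y + 3 <= n)%N ->
  label a b x.+1 y.+1 + label a b x y = label a b x.+1 y + label a b x y.+1.
Proof.
move=> abc le_n.
have [z z0 def_n] : exists2 z, (0 < z)%N & (x + y + z + 2 = n)%N.
  by exists (n - 2 - x - y)%N; lia.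
have := @cut_sum_inverted a b c x.+1 y.+1 z abc.
have := @cut_sum_upright a b c x.+1 y z abc.
have := @cut_sum_upright a b c x y.+1 z abc.
have := @cut_sum_around_hexagon a b c x y z abc.
rewrite /cut_sum; lia.
Qed.

Lemma label_parallelogram a b c x y : uniq [:: a; b; c] ->
  (x + y + 1 <= n)%N ->
  label a b x y + label a b 0 0 = label a b x 0 + label a b 0 y.
Proof.
move=> abc.
have strip x' : (x' + y + 2 <= n)%N ->
    label a b x'.+1 y + label a b x' 0 = label a b x'.+1 0 + label a b x' y.
  elim: y => [//|y' IH] le_n; have := IH ltac:(lia).
  by have := @label_unit_parallelogram a b c x' y' abc ltac:(lia); lia.
elim: x => [|x IH] le_n; first by rewrite addrC.
by have := IH ltac:(lia); have := strip x ltac:(lia); lia.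
Qed.

(** The share of the line a = 2 x in the doubled labels of its crossings with
    the lines of family b. By label_parallelogram a label is a function of x
    plus a function of y; doubling it allows the constant label a b 0 0 to be split
    evenly between the two without leaving the integers. *)
Definition line_part (a b : 'I_3) (x : nat) : int :=
  2 * label a b x 0 - label a b 0 0.

Lemma label_split a b c x y : uniq [:: a; b; c] -> (x + y + 1 <= n)%N ->
  2 * label a b x y = line_part a b x + line_part b a y.
Proof.
move=> abc le_n; have := label_parallelogram abc le_n.
rewrite /line_part !(labelC _ _ abc); lia.
Qed.

(** The total of the two shares of the line a = 0; by line_constE below it is
    the same for all the lines of family a. *)
Definition line_const (a : 'I_3) : int := \sum_(b | b != a) line_part a b 0.

Lemma line_constE0 a b c : uniq [:: a; b; c] ->
  line_const a = line_part a b 0 + line_part a c 0.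
Proof.
move=> abc; rewrite /line_const big_mkcond (sum_distinct3 _ abc) eqxx.
by rewrite !(distinct3E abc) add0r.
Qed.

Lemma cut_sum_split a b c x y z : uniq [:: a; b; c] ->
  (x + y + 1 <= n)%N -> (y + z + 1 <= n)%N -> (z + x + 1 <= n)%N ->
  2 * cut_sum a b c x y z =
    (line_part a b x + line_part a c x) + (line_part b a y + line_part b c y)
    + (line_part c a z + line_part c b z).
Proof.
move=> abc xy yz zx; have bca := distinct3_rot abc.
have := label_split abc xy; have := label_split bca yz.
have := label_split (distinct3_rot bca) zx; rewrite /cut_sum; lia.
Qed.

(** The triangles cut by (x + 1, y, 0) and by (x, y, 0) with x + y = n - 2
    both have sum T, and they differ only in the line of family a, hence in
    its shares. *)
Lemma line_constE a b c x : uniq [:: a; b; c] -> (x < n)%N ->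
  line_part a b x + line_part a c x = line_const a.
Proof.
move=> abc; rewrite (line_constE0 abc); elim: x => [//|x IH] lt_n.
rewrite -IH; last exact: ltnW.
have [y def_n] : exists y, (x + y + 2 = n)%N by exists (n - 2 - x)%N; lia.
have := @cut_sum_upright a b c x.+1 y 0 abc ltac:(lia).
have := @cut_sum_around_hexagon a b c x y 0 abc ltac:(lia).
have := @cut_sum_split a b c x.+1 y 0 abc ltac:(lia) ltac:(lia) ltac:(lia).
have := @cut_sum_split a b c x y 0 abc ltac:(lia) ltac:(lia) ltac:(lia).
lia.
Qed.

Lemma sum_line_const : (0 < n)%N -> \sum_a line_const a = 2 * T%:Z.
Proof.
move=> n0.
have abc : uniq [:: 0; 1; 1 + 1 : 'I_3] by [].
have bca := distinct3_rot abc; have cab := distinct3_rot bca.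
(* The lines n-1, 0, 0 bound the upright face at a corner of the region. *)
rewrite (sum_distinct3 _ abc) -(@cut_sum_upright _ _ _ n.-1 0 0 abc);
  last by lia.
rewrite (cut_sum_split abc) ?(line_constE abc) ?(line_constE0 bca);
  rewrite ?(line_constE0 cab); lia.
Qed.

(** The absolute value only serves to land in nat: the coordinates of a point
    of the region are nonnegative. *)
Definition half (P : point) (a : 'I_3) : nat := (`|P 0%R a| %/ 2)%N.

Lemma vertex_split P a b c : uniq [:: a; b; c] -> P \in region n ->
  evenz (P 0 a) -> evenz (P 0 b) ->
  2 * (phi P)%:Z = line_part a b (half P a) + line_part b a (half P b).
Proof.
move=> abc /and3P[/forallP P0 /eqP sumP _] ev_a ev_b.
rewrite (coord_sumE _ abc) in sumP; rewrite /evenz in ev_a ev_b.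
have Pa := P0 a; have Pb := P0 b; have Pc := P0 c.
rewrite -(label_split abc); last by rewrite /half; lia.
rewrite /label; congr (2 * (phi _)%:Z); rewrite /half.
by_coordinates abc.
Qed.

Lemma half_lt P a : P \in region n -> (half P a < n)%N.
Proof.
move=> /and3P[/forallP P0 /eqP sumP _]; have abc := uniq_succ3 a.
rewrite (coord_sumE _ abc) in sumP.
have := P0 a; have := P0 (a + 1); have := P0 (a + 1 + 1); rewrite /half.
by move: (P 0 a) (P 0 (a + 1)) (P 0 (a + 1 + 1)) sumP; lia.
Qed.

(** * Vertex sums of polygons *)

Section Polygon.

Variables (m : nat) (p : 'I_m -> point) (d : 'I_m -> 'I_6).
Hypothesis reg_p : forall i, p i \in region n.
Hypothesis even_p : forall i, evenz (p i 0 (axis (d i))).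
Hypothesis side_p : forall i, p (ordS i) 0 (axis (d i)) = p i 0 (axis (d i)).

(** The share of the line of side i at its crossing with that of side j. *)
Let part i j := line_part (axis (d i)) (axis (d j)) (half (p i) (axis (d i))).

Lemma label_vertex i : axis (d i) != axis (d (ordS i)) ->
  2 * (phi (p (ordS i)))%:Z = part i (ordS i) + part (ordS i) i.
Proof.
move=> /uniq_third[c abc]; rewrite (vertex_split abc) ?side_p //.
by rewrite /part /half side_p.
Qed.

(** Grouping the shares by side rather than by vertex, the line of each side
    contributes at both of its ends. When the neighbouring sides belong to the
    two other families, these are the two shares that add up to line_const. *)
Lemma sum_vertices :
  (forall i,
     uniq [:: axis (d i); axis (d (ordS i)); axis (d (ordS (ordS i)))]) ->
  2 * (vertex_sum phi p)%:Z = \sum_i line_const (axis (d i)).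
Proof.
move=> abc; rewrite /vertex_sum (big_morph Posz PoszD (erefl 0%:Z)).
rewrite (reindex_inj (@ordS_inj m)) [RHS](reindex_inj (@ordS_inj m)) /=.
rewrite mulr_sumr.
have vertex i : 2 * (phi (p (ordS i)))%:Z = part i (ordS i) + part (ordS i) i.
  by apply: label_vertex; rewrite (distinct3E (abc i)).
rewrite (eq_bigr _ (fun i _ => vertex i)) big_split /=.
rewrite [X in X + _](reindex_inj (@ordS_inj m)) -big_split /=.
apply: eq_bigr => i _; rewrite addrC /part.
by rewrite (line_constE (distinct3_swap (abc i))) ?half_lt.
Qed.

End Polygon.

End Magic.

Theorem theorem4p3 (n : nat) (phi : point -> nat) (hn : (1 <= n)%N)
    (hphi : magic_figure n phi) :
  (exists S : nat,
    (forall p : 'I_3 -> point, lattice_triangle n p -> vertex_sum phi p = S) /\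
    (forall p : 'I_6 -> point, lattice_hexagon n p ->
       vertex_sum phi p = (2 * S)%N)) /\
  (forall p : 'I_4 -> point, lattice_parallelogram n p ->
     (phi (p 0%R) + phi (p 2%R))%N = (phi (p 1%R) + phi (p 3%R))%N).
Proof.
case: hphi => _ [T [H [upright inverted hexagon defH]]].
rewrite {H}defH in hexagon.
have total := sum_line_const upright inverted hexagon hn.
split; first (exists T; split).
- move=> p pgon; have lt23 : (2 < 3)%N by [].
  have [d [head_d even_p side_p]] := polygon_headings lt23 pgon.
  have [cvx_p reg_p _] := pgon.
  have turn_d i := axis_turn (side_turn lt23 cvx_p head_d i).
  have := sum_vertices upright inverted hexagon reg_p even_p side_p.
  have S3 (i : 'I_3) : ordS (ordS (ordS i)) = i.
    by case: i => [[|[|[|//]]] ?]; apply: val_inj.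
  have abc i :
      uniq [:: axis (d i); axis (d (ordS i)); axis (d (ordS (ordS i)))].
    have := turn_d (ordS (ordS i)); rewrite S3 eq_sym => ne_ik.
    by rewrite /= !inE negb_or ne_ik !turn_d.
  move=> /(_ abc).
  have ijk : uniq [:: 0; ordS 0; ordS (ordS 0) : 'I_3] by [].
  by rewrite (sum_distinct3 _ ijk) -(sum_distinct3 _ (abc 0)) total; lia.
- move=> p pgon; have lt26 : (2 < 6)%N by [].
  have [d [head_d even_p side_p]] := polygon_headings lt26 pgon.
  have [cvx_p reg_p _] := pgon.
  have abc i :
      uniq [:: axis (d i); axis (d (ordS i)); axis (d (ordS (ordS i)))].
    rewrite !(hexagon_turn _ cvx_p head_d).
    by case: (d i) => [[|[|[|[|[|[|]]]]]] ?].
  have := sum_vertices upright inverted hexagon reg_p even_p side_p abc.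
  (* Six distinct directions among six: each occurs on exactly one side. *)
  have inj_d := heading_inj lt26 cvx_p head_d.
  have <- : \sum_j line_const n phi (axis j) =
            \sum_i line_const n phi (axis (d i)).
    by rewrite [LHS](reindex_inj inj_d).
  by rewrite sum_axis total; lia.
- move=> p [pgon par]; have lt24 : (2 < 4)%N by [].
  have [d [head_d even_p side_p]] := polygon_headings lt24 pgon.
  have [cvx_p reg_p _] := pgon.
  have turn_d i := axis_turn (side_turn lt24 cvx_p head_d i).
  have vertex i := label_vertex upright inverted hexagon reg_p
    even_p side_p (turn_d i).
  have parallel i : axis (d (ordS (ordS i))) = axis (d i).
    have /eqP := par i; rewrite (cross_heads (head_d _) (head_d _)).
    case/orP=> /eqP->; first by [].
    by case: (d i) => [[|[|[|[|[|[|//]]]]]] ?]; apply: val_inj.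
  (* Each side line has equal shares at both its ends, as the two ends lie on
     lines of the same other family, and so the alternating sum cancels. *)
  have S0 : ordS 0 = 1 :> 'I_4 by apply: val_inj.
  have S1 : ordS 1 = 2%R :> 'I_4 by apply: val_inj.
  have S2 : ordS 2%R = 3%R :> 'I_4 by apply: val_inj.
  have S3 : ordS 3%R = 0 :> 'I_4 by apply: val_inj.
  have := parallel 0; have := parallel 1; rewrite S0 S1 S2 => a31 a20.
  have := vertex 0; have := vertex 1; have := vertex 2%R; have := vertex 3%R.
  by rewrite S0 S1 S2 S3 a31 a20; lia.
Qed.
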